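(* Let $(A,\cdot_A,\Delta_r,\Phi=\{\partial_1,\partial_2\},\Psi=\{\eth_1,\eth_2\})$ be a quasi-triangular (resp. triangular, factorizable) commutative and cocommutative differential ASI bialgebra, with $r\in A\otimes A$, and suppose that $$\eth_2(\partial_1(a))\cdot_A b=\eth_1(\partial_2(a))\cdot_A b\qquad\text{for all }a,b\in A.$$ Let $[a,b]_A=\partial_1(a)\cdot_A\partial_2(b)-\partial_2(a)\cdot_A\partial_1(b)$, so that $(A,[\ ,\ ]_A,\cdot_A)$ is the induced Poisson algebra of $(A,\cdot_A,\Phi)$, and define $\delta_r:A\to A\otimes A$ by $$\delta_r=(\eth_1\otimes\eth_2-\eth_2\otimes\eth_1)\Delta_r.$$ Then $(A,[\ ,\ ]_A,\cdot_A,\delta_r,\Delta_r)$ is a quasi-triangular (resp. triangular, factorizable) Poisson bialgebra through $r$ (in particular $\delta_r(a)=(\mathrm{id}\otimes\mathrm{ad}(a)+\mathrm{ad}(a)\otimes\mathrm{id})(r)$ for all $a\in A$).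
   Context: All vector spaces are finite-dimensional over a field $\mathbb K$ of characteristic $0$; algebras need not be unital. $L(a)b=a\cdot_A b=R(b)a$; $\mathrm{ad}(a)b=[a,b]_A$; $\tau$ is the flip. Differential side. Differential algebra $(A,\cdot_A,\Phi=\{\partial_k\}_{k=1}^m)$: an associative algebra with finitely many pairwise commuting derivations. For a family $\Psi=\{\eth_k:A\to A\}_{k=1}^m$ of pairwise commuting linear maps, it is $\Psi$-admissible if $\eth_k(a)\cdot_A b=a\cdot_A\partial_k(b)+\eth_k(a\cdot_A b)$ and $a\cdot_A\eth_k(b)=\partial_k(a)\cdot_A b+\eth_k(a\cdot_A b)$ for all $a,b,k$. For $r=\sum_i a_i\otimes b_i\in A\otimes A$ let $\mathbf A(r)=\sum_{i,j}(a_i\cdot_A a_j\otimes b_i\otimes b_j+a_i\otimes a_j\otimes b_i\cdot_A b_j-a_i\otimes a_j\cdot_A b_i\otimes b_j)$; $r$ solves the $\Psi$-admissible associative Yang-Baxter equation (AYBE) if $\mathbf A(r)=0$ and $(\partial_k\otimes\mathrm{id}-\mathrm{id}\otimes\eth_k)(r)=0=(\eth_k\otimes\mathrm{id}-\mathrm{id}\otimes\partial_k)(r)$ for all $k$. $s\in A\otimes A$ is $L$-invariant if $(L(a)\otimes\mathrm{id}-\mathrm{id}\otimes R(a))(s)=0$ for all $a$. Put $\Delta_r(a)=(\mathrm{id}\otimes L(a)-R(a)\otimes\mathrm{id})(r)$. If $(A,\cdot_A,\Phi)$ is $\Psi$-admissible, $r$ solves the $\Psi$-admissible AYBE and the symmetric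 part $\frac12(r+\tau(r))$ is $L$-invariant, then $(A,\cdot_A,\Delta_r,\Phi,\Psi)$ is a differential antisymmetric infinitesimal (ASI) bialgebra (known), called quasi-triangular; it is triangular if $r$ is antisymmetric, and factorizable if the symmetric part of $r$ is nondegenerate (as a map $A^*\to A$). It is commutative and cocommutative if $\cdot_A$ is commutative and $\Delta_r=\tau\Delta_r$. Poisson side. A Poisson algebra $(A,[\ ,\ ]_A,\cdot_A)$ is a Lie algebra and a commutative associative algebra on the same space with $[a,b\cdot_A c]_A=[a,b]_A\cdot_A c+b\cdot_A[a,c]_A$. It is known that the bracket in the claim makes $A$ a Poisson algebra. Poisson bialgebra $(A,[\ ,\ ]_A,\cdot_A,\delta,\Delta)$: a Poisson algebra with linear maps $\delta,\Delta:A\to A\otimes A$ such that the dual operations $\langle[x^*,y^*]_{A^*},a\rangle=\langle\delta(a),x^*\otimes y^*\rangle$, $\langle x^*\cdot_{A^*}y^*,a\rangle=\langle\Delta(a),x^*\otimes y^*\rangle$ make $A^*$ a Poisson algebra and, for all $a,b$: $\delta([a,b]_A)=(\mathrm{ad}(a)\otimes\mathrm{id}+\mathrm{id}\otimes\mathrm{ad}(a))\delta(b)-(\mathrm{ad}(b)\otimes\mathrm{id}+\mathrm{id}\otimes\mathrm{ad}(b))\delta(a)$; $\Delta(a\cdot_A b)=(L(a)\otimes\mathrm{id})\Delta(b)+(\mathrm{id}\otimes L(b))\Delta(a)$; $\delta(a\cdot_A b)=(L(a)\otimes\mathrm{id})\delta(b)+(L(b)\otimes\mathrm{id})\delta(a)+(\mathrm{id}\otimes\mathrm{ad}(a))\Delta(b)+(\mathrm{id}\otimes\mathrm{ad}(b))\Delta(a)$;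 $\Delta([a,b]_A)=(\mathrm{ad}(a)\otimes\mathrm{id}+\mathrm{id}\otimes\mathrm{ad}(a))\Delta(b)+(L(b)\otimes\mathrm{id}-\mathrm{id}\otimes L(b))\delta(a)$. Such a bialgebra is quasi-triangular (through $r$) if $\delta(a)=(\mathrm{id}\otimes\mathrm{ad}(a)+\mathrm{ad}(a)\otimes\mathrm{id})(r)$ and $\Delta(a)=(\mathrm{id}\otimes L(a)-L(a)\otimes\mathrm{id})(r)$ for some $r=\sum_i a_i\otimes b_i$ such that (i) $r$ solves the Poisson Yang-Baxter equation: $\mathbf A(r)=0$ and $\mathbf C(r)=\sum_{i,j}([a_i,a_j]_A\otimes b_i\otimes b_j+a_i\otimes a_j\otimes[b_i,b_j]_A+a_i\otimes[b_i,a_j]_A\otimes b_j)=0$; (ii) $s=\frac12(r+\tau(r))$ is $(\mathrm{ad},L)$-invariant: $(\mathrm{ad}(a)\otimes\mathrm{id}+\mathrm{id}\otimes\mathrm{ad}(a))(s)=0=(L(a)\otimes\mathrm{id}-\mathrm{id}\otimes L(a))(s)$ for all $a$. (It is known that (i) and (ii) imply that these $\delta,\Delta$ define a Poisson bialgebra.) It is triangular if $r$ is antisymmetric, and factorizable if $s$ is nondegenerate. *)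

(* Defs.v *)
From HB Require Import structures.
From mathcomp Require Import all_boot all_order all_algebra.
Set Implicit Arguments.
Unset Strict Implicit.
Unset Printing Implicit Defensive.
Import GRing.Theory.
Local Open Scope ring_scope.

Definition bilinear_map (K : fieldType) (U V W : vectType K)
    (f : U -> V -> W) : Prop :=
  (forall u, linear (f u)) /\ (forall v, linear (f^~ v)).

Section Tensor.
Variable K : fieldType.
Implicit Types U V W : vectType K.

(* U ⊗ V is realised by the matrices of coefficients on the products of the
   vectors of the bases vbasis {:U} and vbasis {:V}; the lemmas tens_span,
   tlift_pure and tlift_unique state that it has the universal property of the
   tensor product.  A triple tensor product is read as (A ⊗ A) ⊗ A. *)
Definition tens U V : vectType K := 'M[K]_(\dim {:U}, \dim {:V}).

Definition pure U V (u : U) (v : V) : tens U V :=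
  \matrix_(i, j) (coord (vbasis {:U}) i u * coord (vbasis {:V}) j v).

(* tlift f (\sum_i u_i ⊗ v_i) = \sum_i f u_i v_i when f is bilinear. *)
Definition tlift U V W (f : U -> V -> W) (t : tens U V) : W :=
  \sum_i \sum_j (t : 'M[K]_(_, _)) i j *: f (vbasis {:U})`_i (vbasis {:V})`_j.

Definition tmap U V U' V' (f : U -> U') (g : V -> V') (t : tens U V) :
    tens U' V' :=
  tlift (fun u v => pure (f u) (g v)) t.

Definition flip U V (t : tens U V) : tens V U :=
  tlift (fun u v => pure v u) t.

Definition dual V : vectType K := 'Hom(V, K^o).

Definition tpair U V (x : dual U) (y : dual V) (t : tens U V) : K :=
  tlift (W := K^o) (fun u v => (x u * y v : K)) t.

(* The map U^* -> V given by x |-> (x ⊗ id)(t). *)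
Definition sharp U V (t : tens U V) (x : dual U) : V :=
  tlift (fun u v => (x u : K) *: v) t.

Definition nondegenerate U V (t : tens U V) : Prop := bijective (sharp t).

End Tensor.

Notation "u ⊗ v" := (pure u v) (at level 40, left associativity) : ring_scope.

Section TensorTheory.
Variable K : fieldType.
Implicit Types U V W : vectType K.

Lemma pure_bilinear U V : bilinear_map (@pure K U V).
Proof.
split=> [u c v v'|v c u u']; apply/matrixP=> i j; rewrite !mxE linearP /=.
  by rewrite mulrDr mulrCA.
by rewrite mulrDl mulrA.
Qed.

Lemma tlift_linear U V W (f : U -> V -> W) : linear (tlift f).
Proof.
move=> c s t; rewrite /tlift scaler_sumr -big_split; apply: eq_bigr => i _ /=.
rewrite scaler_sumr -big_split; apply: eq_bigr => j _ /=.
by rewrite !mxE scalerDl scalerA.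
Qed.

Lemma linear_sumZ U W (f : U -> W) (I : finType) (c : I -> K) (u : I -> U) :
  linear f -> f (\sum_i c i *: u i) = \sum_i c i *: f (u i).
Proof.
move=> fL; pose g := linfun (HB.pack_for {linear U -> W} f
  (GRing.isLinear.Build K U W *:%R f fL)).
have fE x : f x = g x by rewrite lfunE.
by rewrite fE linear_sum; apply: eq_bigr => i _; rewrite linearZ fE.
Qed.

Lemma tlift_pure U V W (f : U -> V -> W) u v :
  bilinear_map f -> tlift f (u ⊗ v) = f u v.
Proof.
move=> [fr fl]; have /= Eu := coord_vbasis (memvf u).
have /= Ev := coord_vbasis (memvf v).
rewrite {2}Eu (linear_sumZ _ _ (fl v)) /tlift; apply: eq_bigr => i _.
rewrite {2}Ev (linear_sumZ _ _ (fr _)) scaler_sumr.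
by apply: eq_bigr => j _; rewrite mxE scalerA.
Qed.

Lemma tens_span U V (t : tens U V) :
  t = \sum_i \sum_j (t : 'M[K]_(_, _)) i j *:
        ((vbasis {:U})`_i ⊗ (vbasis {:V})`_j).
Proof.
have fU := basis_free (vbasisP {:U}); have fV := basis_free (vbasisP {:V}).
apply/matrixP=> k l; rewrite summxE (bigD1 k) //= summxE (bigD1 l) //= !mxE.
rewrite !coord_free // !eqxx !mulr1 !big1 ?addr0 // => [i ik|j jl].
  rewrite summxE big1 // => j _; rewrite !mxE !coord_free //.
  by rewrite (negPf ik) mul0r mulr0.
by rewrite !mxE !coord_free // (negPf jl) !mulr0.
Qed.

Lemma tlift_unique U V W (f : U -> V -> W) (g : tens U V -> W) :
  linear g -> (forall u v, g (u ⊗ v) = f u v) -> g =1 tlift f.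
Proof.
move=> gL gE t; rewrite {1}[t]tens_span /tlift.
pose g' : {linear tens U V -> W} := HB.pack_for {linear tens U V -> W} g
  (GRing.isLinear.Build K (tens U V) W *:%R g gL).
rewrite -[g _]/(g' _) linear_sum; apply: eq_bigr => i _.
rewrite linear_sum; apply: eq_bigr => j _.
by rewrite linearZ /= gE.
Qed.

End TensorTheory.

Section Algebra.
Variables (K : fieldType) (A : vectType K).
Implicit Types (mul br : A -> A -> A) (r s t : tens A A).

Record associative_algebra mul : Prop := AssociativeAlgebra {
  assoc_bilinear : bilinear_map mul;
  assoc_mulA : associative mul }.

Definition symmetric_part r : tens A A := 2%:R^-1 *: (r + flip r).

Definition antisymmetric r : Prop := flip r = - r.

(* For r = \sum_i a_i ⊗ b_i, the pair (a, b) runs over the (a_i, b_i) and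
   (a', b') runs over the (a_j, b_j); see AYB_sum and CYB_sum. *)
Definition AYB mul r : tens (tens A A) A :=
  tlift (fun a b => tlift (fun a' b' =>
      mul a a' ⊗ b ⊗ b' + a ⊗ a' ⊗ mul b b' - a ⊗ mul a' b ⊗ b') r) r.

Definition CYB br r : tens (tens A A) A :=
  tlift (fun a b => tlift (fun a' b' =>
      br a a' ⊗ b ⊗ b' + a ⊗ a' ⊗ br b b' + a ⊗ br b a' ⊗ b') r) r.

Lemma tlift2_sum (W : vectType K) (F : A -> A -> A -> A -> W) n
    (a b : 'I_n -> A) :
    (forall x y, bilinear_map (F x y)) ->
    (forall x y, bilinear_map (fun z w => F z w x y)) ->
  let r := \sum_i a i ⊗ b i in
  tlift (fun x y => tlift (F x y) r) r =
  \sum_i \sum_j F (a i) (b i) (a j) (b j).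
Proof.
move=> Fr Fl r.
have sumE (G : A -> A -> W) : bilinear_map G -> tlift G r = \sum_i G (a i) (b i).
  move=> GB; pose g := HB.pack_for {linear tens A A -> W} (tlift G)
    (GRing.isLinear.Build K _ _ *:%R (tlift G) (tlift_linear G)).
  rewrite -[tlift G r]/(g r) linear_sum; apply: eq_bigr => i _ /=.
  exact: tlift_pure.
rewrite sumE; first by apply: eq_bigr => i _; apply: sumE.
split=> x c y z; rewrite !sumE // scaler_sumr -big_split; apply: eq_bigr => i _ /=.
  exact: (Fl _ _).1.
exact: (Fl _ _).2.
Qed.

Lemma bilinear_rules (U V W : vectType K) (f : U -> V -> W) :
  bilinear_map f ->
  (forall c u v v', f u (c *: v + v') = c *: f u v + f u v') *
  (forall c u u' v, f (c *: u + u') v = c *: f u v + f u' v).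
Proof. by case=> fr fl; split=> c u v w; [exact: fr|exact: (fl w)]. Qed.

Lemma linear3 (U W : vectType K) (f g h : U -> W) :
  linear f -> linear g -> linear h -> linear (fun u => f u + g u + h u).
Proof.
move=> fL gL hL c u v; rewrite fL gL hL !scalerDr.
by rewrite [X in X + _ = _]addrACA [LHS]addrACA.
Qed.

Lemma linear_opp (U W : vectType K) (f : U -> W) :
  linear f -> linear (fun u => - f u).
Proof. by move=> fL c u v; rewrite fL opprD scalerN. Qed.

Lemma AYB_sum mul n (a b : 'I_n -> A) : bilinear_map mul ->
  AYB mul (\sum_i a i ⊗ b i) =
  \sum_i \sum_j (mul (a i) (a j) ⊗ b i ⊗ b j + a i ⊗ a j ⊗ mul (b i) (b j)
                 - a i ⊗ mul (a j) (b i) ⊗ b j).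
Proof.
move=> mulB; have mE := bilinear_rules mulB.
have pE := bilinear_rules (pure_bilinear A A).
have qE := bilinear_rules (pure_bilinear (tens A A) A).
rewrite /AYB tlift2_sum // => x y; split=> z; apply: linear3;
  try apply: linear_opp; move=> c u v; by rewrite ?mE ?pE ?qE.
Qed.

Lemma CYB_sum br n (a b : 'I_n -> A) : bilinear_map br ->
  CYB br (\sum_i a i ⊗ b i) =
  \sum_i \sum_j (br (a i) (a j) ⊗ b i ⊗ b j + a i ⊗ a j ⊗ br (b i) (b j)
                 + a i ⊗ br (b i) (a j) ⊗ b j).
Proof.
move=> brB; have bE := bilinear_rules brB.
have pE := bilinear_rules (pure_bilinear A A).
have qE := bilinear_rules (pure_bilinear (tens A A) A).
rewrite /CYB tlift2_sum // => x y; split=> z; apply: linear3;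
  move=> c u v; by rewrite ?bE ?pE ?qE.
Qed.

Section Differential.
Variable m : nat.
Implicit Types Phi Psi : m.-tuple 'End(A).

Definition pairwise_commuting Phi : Prop :=
  forall k l a, tnth Phi k (tnth Phi l a) = tnth Phi l (tnth Phi k a).

Definition derivation mul (d : 'End(A)) : Prop :=
  forall a b, d (mul a b) = mul (d a) b + mul a (d b).

Record differential_algebra mul Phi : Prop := DifferentialAlgebra {
  diff_assoc : associative_algebra mul;
  diff_derivation : forall k, derivation mul (tnth Phi k);
  diff_commuting : pairwise_commuting Phi }.

Record admissible mul Phi Psi : Prop := Admissible {
  adm_commuting : pairwise_commuting Psi;
  adm_left : forall k a b,
    mul (tnth Psi k a) b = mul a (tnth Phi k b) + tnth Psi k (mul a b);
  adm_right : forall k a b,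
    mul a (tnth Psi k b) = mul (tnth Phi k a) b + tnth Psi k (mul a b) }.

Record admissible_AYBE mul Phi Psi r : Prop := AdmissibleAYBE {
  aybe_AYB : AYB mul r = 0;
  aybe_Phi : forall k, tmap (tnth Phi k) id r - tmap id (tnth Psi k) r = 0;
  aybe_Psi : forall k, tmap (tnth Psi k) id r - tmap id (tnth Phi k) r = 0 }.

Definition L_invariant mul s : Prop :=
  forall a, tmap (mul a) id s - tmap id (mul^~ a) s = 0.

Definition Delta mul r (a : A) : tens A A :=
  tmap id (mul a) r - tmap (mul^~ a) id r.

(* (A, mul, Delta mul r, Phi, Psi) is a quasi-triangular differential ASI
   bialgebra; the comultiplication is determined by r. *)
Record quasi_triangular_dASI mul Phi Psi r : Prop := QuasiTriangularDASI {
  qt_diff : differential_algebra mul Phi;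
  qt_admissible : admissible mul Phi Psi;
  qt_AYBE : admissible_AYBE mul Phi Psi r;
  qt_invariant : L_invariant mul (symmetric_part r) }.

Definition triangular_dASI mul Phi Psi r : Prop :=
  quasi_triangular_dASI mul Phi Psi r /\ antisymmetric r.

Definition factorizable_dASI mul Phi Psi r : Prop :=
  quasi_triangular_dASI mul Phi Psi r /\ nondegenerate (symmetric_part r).

Definition commutative_cocommutative mul (D : A -> tens A A) : Prop :=
  commutative mul /\ forall a, D a = flip (D a).

End Differential.

End Algebra.

Record lie_algebra (K : fieldType) (V : vectType K) (br : V -> V -> V) : Prop :=
  LieAlgebra {
  lie_bilinear : bilinear_map br;
  lie_alternating : forall a, br a a = 0;
  lie_jacobi : forall a b c,
    br a (br b c) + br b (br c a) + br c (br a b) = 0 }.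

Record poisson_algebra (K : fieldType) (V : vectType K)
    (br mul : V -> V -> V) : Prop := PoissonAlgebra {
  poisson_lie : lie_algebra br;
  poisson_assoc : associative_algebra mul;
  poisson_mulC : commutative mul;
  poisson_leibniz : forall a b c,
    br a (mul b c) = mul (br a b) c + mul b (br a c) }.

Section PoissonBialgebra.
Variables (K : fieldType) (A : vectType K).
Implicit Types (mul br : A -> A -> A) (delta Delta : A -> tens A A).
Implicit Types r s : tens A A.

Definition dual_op (D : A -> tens A A) (x y : dual A) : dual A :=
  linfun (fun a => tpair x y (D a) : K^o).

Lemma dual_opE (D : A -> tens A A) x y a :
  linear D -> dual_op D x y a = tpair x y (D a).
Proof.
move=> DL; have fL : linear (fun a => tpair x y (D a) : K^o).
  by move=> c u v; rewrite DL; apply: tlift_linear.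
pose f := HB.pack_for {linear A -> K^o} (fun a => tpair x y (D a) : K^o)
  (GRing.isLinear.Build K A K^o *:%R _ fL).
exact: (lfunE f).
Qed.

Record poisson_bialgebra br mul delta Delta : Prop := PoissonBialgebra {
  pb_poisson : poisson_algebra br mul;
  pb_delta_linear : linear delta;
  pb_Delta_linear : linear Delta;
  pb_dual_poisson : poisson_algebra (dual_op delta) (dual_op Delta);
  pb_delta_br : forall a b, delta (br a b) =
    (tmap (br a) id (delta b) + tmap id (br a) (delta b))
    - (tmap (br b) id (delta a) + tmap id (br b) (delta a));
  pb_Delta_mul : forall a b, Delta (mul a b) =
    tmap (mul a) id (Delta b) + tmap id (mul b) (Delta a);
  pb_delta_mul : forall a b, delta (mul a b) =
    tmap (mul a) id (delta b) + tmap (mul b) id (delta a)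
    + tmap id (br a) (Delta b) + tmap id (br b) (Delta a);
  pb_Delta_br : forall a b, Delta (br a b) =
    (tmap (br a) id (Delta b) + tmap id (br a) (Delta b))
    + (tmap (mul b) id (delta a) - tmap id (mul b) (delta a)) }.

Definition poisson_YBE br mul r : Prop := AYB mul r = 0 /\ CYB br r = 0.

Definition ad_L_invariant br mul s : Prop :=
  forall a, tmap (br a) id s + tmap id (br a) s = 0 /\
            tmap (mul a) id s - tmap id (mul a) s = 0.

Record quasi_triangular_poisson br mul delta Delta r : Prop :=
  QuasiTriangularPoisson {
  qtp_bialgebra : poisson_bialgebra br mul delta Delta;
  qtp_delta : forall a, delta a = tmap id (br a) r + tmap (br a) id r;
  qtp_Delta : forall a, Delta a = tmap id (mul a) r - tmap (mul a) id r;
  qtp_YBE : poisson_YBE br mul r;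
  qtp_invariant : ad_L_invariant br mul (symmetric_part r) }.

Definition triangular_poisson br mul delta Delta r : Prop :=
  quasi_triangular_poisson br mul delta Delta r /\ antisymmetric r.

Definition factorizable_poisson br mul delta Delta r : Prop :=
  quasi_triangular_poisson br mul delta Delta r /\
  nondegenerate (symmetric_part r).

End PoissonBialgebra.

(* Main.v *)
Require Import Defs.
From HB Require Import structures.
From mathcomp Require Import all_boot all_order all_algebra.
From mathcomp Require Import ring.
Import GRing.Theory.
Local Open Scope ring_scope.

(* The conditions on r let every d_k on one factor of r be traded for e_k on
   the other factor.  With the admissibility identities this turns
   (e1 ⊗ e2 - e2 ⊗ e1) Delta_t(a) into the coboundary
   (id ⊗ ad(a) + ad(a) ⊗ id)(t), both for t = r and for t = s, the symmetric
   part of r; since Delta_s = 0 by L-invariance, s is ad-invariant.  In the same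
   way C(r) = (id ⊗ e1 ⊗ e2 - id ⊗ e2 ⊗ e1) A(r) = 0.  The compatibility
   conditions of a Poisson bialgebra are then formal identities for coboundaries.
   On the dual space, A(r) = 0 says that one contraction A^* -> A of r is
   multiplicative and that the opposite of the other one is, which gives the
   associativity of the dual product.  The transposes of e1 and e2 are commuting
   derivations of it, and the dual bracket is the one they induce, so that the
   dual is Poisson for the same reason as A is. *)

Set Implicit Arguments.
Unset Strict Implicit.
Unset Printing Implicit Defensive.

(** * Linear and bilinear maps as rewriting rules *)

Section Linear.
Variable K : fieldType.
Implicit Types U V W : vectType K.

Lemma linear_zero U W (f : U -> W) : linear f -> f 0 = 0.
Proof.
move=> fL; apply: (@addrI _ (f 0)).
by rewrite addr0 -{1}[f 0]scale1r -fL scale1r addr0.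
Qed.

Lemma linear_rules U W (f : U -> W) : linear f ->
  ((forall u v, f (u + v) = f u + f v) * (forall u, f (- u) = - f u))
  * (forall c u, f (c *: u) = c *: f u).
Proof.
move=> fL.
have fZ c u : f (c *: u) = c *: f u.
  by rewrite -[c *: u]addr0 fL linear_zero // addr0.
split=> //; split=> u; first by move=> v; rewrite -[u]scale1r fL !scale1r.
by rewrite -scaleN1r fZ scaleN1r.
Qed.

(** Additivity, opposites and scalars are kept apart, so that one multirule expands sums and
    differences in which no scalar is visible. *)
Lemma bilinear_map_rules U V W (f : U -> V -> W) : bilinear_map f ->
  ((forall u v v', f u (v + v') = f u v + f u v') *
   (forall u u' v, f (u + u') v = f u v + f u' v)) *
  ((forall u v, f u (- v) = - f u v) * (forall u v, f (- u) v = - f u v)) *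
  ((forall c u v, f u (c *: v) = c *: f u v) *
   (forall c u v, f (c *: u) v = c *: f u v)).
Proof.
move=> [fr fl]; have fR u := linear_rules (fr u).
have fL v := linear_rules (fl v).
do !split=> *; try by rewrite fR.
- exact: (fL _).1.1.
- exact: (fL _).1.2.
exact: (fL _).2.
Qed.

Lemma coord_inj U (u v : U) :
  (forall i, coord (vbasis {:U}) i u = coord (vbasis {:U}) i v) -> u = v.
Proof.
move=> uv; rewrite (coord_vbasis (memvf u)) (coord_vbasis (memvf v)).
by apply: eq_bigr => i _; rewrite uv.
Qed.

End Linear.

(** * Calculus of maps out of a tensor product *)

Section Tlift.
Variable K : fieldType.
Implicit Types U V W X : vectType K.

Lemma eq_tlift U V W (f g : U -> V -> W) (t : tens U V) :
  (forall u v, f u v = g u v) -> tlift f t = tlift g t.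
Proof. by move=> fg; do 2![apply: eq_bigr => ? _]; rewrite fg. Qed.

Lemma tliftD U V W (f g : U -> V -> W) (t : tens U V) :
  tlift f t + tlift g t = tlift (fun u v => f u v + g u v) t.
Proof.
rewrite /tlift -big_split; apply: eq_bigr => i _ /=.
by rewrite -big_split; apply: eq_bigr => j _ /=; rewrite scalerDr.
Qed.

Lemma linear_tlift U V W X (L : W -> X) (f : U -> V -> W) (t : tens U V) :
  linear L -> L (tlift f t) = tlift (fun u v => L (f u v)) t.
Proof.
move=> LL; pose g := linfun (HB.pack_for {linear W -> X} L
  (GRing.isLinear.Build K W X *:%R L LL)).
have gE x : L x = g x by rewrite lfunE.
rewrite gE !linear_sum; apply: eq_bigr => i _; rewrite linear_sum.
by apply: eq_bigr => j _; rewrite linearZ gE.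
Qed.

Lemma tliftN U V W (f : U -> V -> W) (t : tens U V) :
  - tlift f t = tlift (fun u v => - f u v) t.
Proof. by apply: (@linear_tlift _ _ _ _ -%R) => c u v; rewrite linearP. Qed.

Lemma tliftZ U V W (f : U -> V -> W) c (t : tens U V) :
  c *: tlift f t = tlift (fun u v => c *: f u v) t.
Proof.
by apply: (@linear_tlift _ _ _ _ ( *:%R c)) => d u v; rewrite linearP.
Qed.

Lemma tlift_rules U V W (f : U -> V -> W) :
  ((forall s t, tlift f (s + t) = tlift f s + tlift f t) *
  (forall t, tlift f (- t) = - tlift f t)) *
  (forall c t, tlift f (c *: t) = c *: tlift f t).
Proof. exact: linear_rules (tlift_linear f). Qed.

Lemma tlift_tmap U V U' V' W (f : U -> U') (g : V -> V') (h : U' -> V' -> W)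
    (t : tens U V) : bilinear_map h ->
  tlift h (tmap f g t) = tlift (fun u v => h (f u) (g v)) t.
Proof.
move=> hB; rewrite (linear_tlift _ _ (tlift_linear h)).
by apply: eq_tlift => u v; rewrite tlift_pure.
Qed.

Lemma pure_comp_bilinear U V U' V' (f : U -> U') (g : V -> V') :
  linear f -> linear g -> bilinear_map (fun u v => f u ⊗ g v).
Proof.
have pE := bilinear_rules (pure_bilinear U' V').
by move=> fL gL; split=> u c v w; rewrite ?fL ?gL pE.
Qed.

Lemma tmap_comp U V U' V' U'' V'' (f : U -> U') (g : V -> V')
    (f' : U' -> U'') (g' : V' -> V'') (t : tens U V) :
  linear f' -> linear g' ->
  tmap f' g' (tmap f g t) = tmap (fun u => f' (f u)) (fun v => g' (g v)) t.
Proof.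
by move=> fL gL; rewrite {1}/tmap tlift_tmap //; apply: pure_comp_bilinear.
Qed.

Lemma eq_tmap U V U' V' (f f' : U -> U') (g g' : V -> V') (t : tens U V) :
  f =1 f' -> g =1 g' -> tmap f g t = tmap f' g' t.
Proof. by move=> ff' gg'; apply: eq_tlift => u v; rewrite ff' gg'. Qed.

Lemma tmap_flip U V U' V' (f : U -> U') (g : V -> V') (t : tens U V) :
  linear f -> linear g -> tmap g f (flip t) = flip (tmap f g t).
Proof.
move=> fL gL; have sB U0 V0 : bilinear_map (fun u : U0 => (@pure K V0 U0)^~ u).
  have pE := bilinear_rules (pure_bilinear V0 U0).
  by split=> u c v w; rewrite pE.
rewrite [RHS]tlift_tmap // /tmap /flip (linear_tlift _ _ (tlift_linear _)).
by apply: eq_tlift => u v; rewrite tlift_pure //; apply: pure_comp_bilinear.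
Qed.

Lemma tlift_bilinear U V U' V' W (F : U -> V -> U' -> V' -> W)
    (t : tens U' V') :
  (forall x y, bilinear_map (fun u v => F u v x y)) ->
  bilinear_map (fun u v => tlift (F u v) t).
Proof.
move=> FB; split=> u c v w; rewrite tliftZ tliftD; apply: eq_tlift => x y.
  exact: (FB x y).1.
exact: (FB x y).2.
Qed.

Lemma tlift_exchange U V U' V' W (F : U -> V -> U' -> V' -> W) t
    (t' : tens U' V') :
  tlift (fun u v => tlift (F u v) t') t =
  tlift (fun u' v' => tlift (fun u v => F u v u' v') t) t'.
Proof.
rewrite /tlift.
under eq_bigr do under eq_bigr do
  (rewrite scaler_sumr; under eq_bigr do rewrite scaler_sumr).
under [RHS]eq_bigr do under eq_bigr do
  (rewrite scaler_sumr; under eq_bigr do rewrite scaler_sumr).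
under eq_bigr do rewrite exchange_big.
rewrite exchange_big; apply: eq_bigr => i _ /=.
under eq_bigr do rewrite exchange_big.
rewrite exchange_big; apply: eq_bigr => j _ /=.
apply: eq_bigr => k _; apply: eq_bigr => l _.
by rewrite !scalerA mulrC.
Qed.

End Tlift.

(* Taking coordinates turns an identity in an abelian group, where ring does
   not apply, into one in the field. *)
Ltac zmod := apply: coord_inj => ?; rewrite ?(linearD, linearN) /=; ring.

(** * The Poisson bracket induced by two commuting derivations *)

Section DifferentialPoisson.
Variables (K : fieldType) (V : vectType K).
Variables (mul br : V -> V -> V) (D1 D2 : V -> V).
Hypotheses (mulA : associative_algebra mul) (mulC : commutative mul).
Hypotheses (D1L : linear D1) (D2L : linear D2).
Hypothesis D1M : forall a b, D1 (mul a b) = mul (D1 a) b + mul a (D1 b).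
Hypothesis D2M : forall a b, D2 (mul a b) = mul (D2 a) b + mul a (D2 b).
Hypothesis D12 : forall a, D1 (D2 a) = D2 (D1 a).
Hypothesis brE : forall a b, br a b = mul (D1 a) (D2 b) - mul (D2 a) (D1 b).

(** The space, the derivations and the bracket are abstract because this serves twice: for [A] with
    [d1], [d2], and for the dual of [A] with the transposes of [e1], [e2], whose bracket is known
    only pointwise through [brE]. *)
Lemma differential_poisson_algebra : poisson_algebra br mul.
Proof.
have mE := bilinear_map_rules (assoc_bilinear mulA).
have mA := assoc_mulA mulA.
have E1 := linear_rules D1L; have E2 := linear_rules D2L.
(* T lets the three cyclic instances be written with their factors in the
   same order, after which they cancel termwise. *)
have br2 (T : V -> V -> V -> V) : (forall x y z, mul x (mul y z) = T x y z) ->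
    forall a b c, br a (br b c) =
    T (D1 a) (D2 (D1 b)) (D2 c) + T (D1 a) (D1 b) (D2 (D2 c))
    - T (D1 a) (D2 (D2 b)) (D1 c) - T (D1 a) (D2 b) (D2 (D1 c))
    - T (D2 a) (D1 (D1 b)) (D2 c) - T (D2 a) (D1 b) (D2 (D1 c))
    + T (D2 a) (D2 (D1 b)) (D1 c) + T (D2 a) (D2 b) (D1 (D1 c)).
  move=> TE a b c; rewrite !brE E1.1.1 E2.1.1 E1.1.2 E2.1.2 !D1M !D2M !D12.
  by rewrite !mE !TE; zmod.
split=> //; first split.
- by split=> x c y z; rewrite !brE ?D1L ?D2L !mE; zmod.
- by move=> a; rewrite brE mulC subrr.
- move=> a b c; have zxy x y z : mul x (mul y z) = mul z (mul x y).
    by rewrite mulC -mA mulC -mA mulC -mA.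
  rewrite (br2 _ (fun x y z => erefl)) (br2 _ zxy).
  rewrite (br2 _ (fun x y z => etrans (zxy x y z) (zxy z x y))).
  by zmod.
move=> a b c; rewrite !brE D1M D2M !mE !mA ![mul (_ a) b]mulC -!mA.
by zmod.
Qed.

End DifferentialPoisson.

(** * Compatibility conditions for coboundaries over a Poisson algebra *)

Section PoissonCoboundary.
Variables (K : fieldType) (A : vectType K) (br mul : A -> A -> A).
Hypothesis brP : poisson_algebra br mul.
Variable r : tens A A.
Let delta a := tmap id (br a) r + tmap (br a) id r.
Let D a := tmap id (mul a) r - tmap (mul a) id r.

Let mulL a : linear (mul a).
Proof. by case: brP => _ [[mL _] _] _ _; apply: mL. Qed.
Let brL a : linear (br a).
Proof. by case: brP => [[[bL _] _ _] _ _ _]; apply: bL. Qed.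
Let idL : linear (@id A). Proof. by []. Qed.
Let mE := bilinear_map_rules (assoc_bilinear (poisson_assoc brP)).
Let bE := bilinear_map_rules (lie_bilinear (poisson_lie brP)).
Let mA := assoc_mulA (poisson_assoc brP).
Let mC := poisson_mulC brP.
Let pE := bilinear_map_rules (pure_bilinear A A).

Let brN a b : br b a = - br a b.
Proof.
have bb := lie_alternating (poisson_lie brP).
have := bb (a + b); rewrite !bE !bb add0r addr0 => /eqP.
by rewrite addr_eq0 => /eqP.
Qed.

(** Jacobi makes ad a morphism of Lie algebras; the mixed terms [a,u] ⊗ [b,v] and [b,u] ⊗ [a,v] are
    symmetric in a and b, so they cancel. *)
Lemma coboundary_delta_br a b : delta (br a b) =
    (tmap (br a) id (delta b) + tmap id (br a) (delta b))
    - (tmap (br b) id (delta a) + tmap id (br b) (delta a)).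
Proof.
have J c : br (br a b) c = br a (br b c) - br b (br a c).
  have:= lie_jacobi (poisson_lie brP) a b c.
  by rewrite (brN a c) (brN (br a b) c) !bE => /eqP; rewrite subr_eq0 => /eqP.
(* The outer maps are distributed over the sums and composed with the inner ones; everything is then
   gathered in one [tlift], which leaves an identity about a single u ⊗ v. *)
rewrite /delta /tmap !tlift_rules -!/(tmap _ _ _) !tmap_comp //.
rewrite /tmap !(tliftD, tliftN); apply: eq_tlift => u v /=.
by rewrite !J !pE; zmod.
Qed.

Lemma coboundary_Delta_mul a b : D (mul a b) =
    tmap (mul a) id (D b) + tmap id (mul b) (D a).
Proof.
rewrite /D /tmap !tlift_rules -!/(tmap _ _ _) !tmap_comp //.
rewrite /tmap !(tliftD, tliftN); apply: eq_tlift => u v /=.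
by rewrite (mA b) (mC b a) -!mA; zmod.
Qed.

(** The mixed terms au ⊗ [b,v] and bu ⊗ [a,v] cancel. On the second factor [a,bv] + [b,av] remains,
    where [a,b]v and [b,a]v cancel, so that it equals [ab,v]. *)
Lemma coboundary_delta_mul a b : delta (mul a b) =
    tmap (mul a) id (delta b) + tmap (mul b) id (delta a)
    + tmap id (br a) (D b) + tmap id (br b) (D a).
Proof.
have L := poisson_leibniz brP.
have brM c : br (mul a b) c = mul a (br b c) + mul b (br a c).
  by rewrite brN L !(brN _ c) !mE (mC (br a c)); zmod.
rewrite /delta /D /tmap !tlift_rules -!/(tmap _ _ _) !tmap_comp //.
rewrite /tmap !(tliftD, tliftN); apply: eq_tlift => u v /=.
by rewrite !brM !L (brN a b) !mE !pE; zmod.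
Qed.

Lemma coboundary_Delta_br a b : D (br a b) =
    (tmap (br a) id (D b) + tmap id (br a) (D b))
    + (tmap (mul b) id (delta a) - tmap id (mul b) (delta a)).
Proof.
have L := poisson_leibniz brP.
rewrite /delta /D /tmap !tlift_rules -!/(tmap _ _ _) !tmap_comp //.
rewrite /tmap !(tliftD, tliftN); apply: eq_tlift => u v /=.
by rewrite !L !pE; zmod.
Qed.

End PoissonCoboundary.

(** This is how the linear conditions on r are used: they move an operator from one argument of any
    bilinear expression to the other. *)
Lemma tlift_transfer (K : fieldType) (U V W : vectType K) (d : U -> U)
    (e : V -> V) (h : U -> V -> W) (t : tens U V) : bilinear_map h ->
  tmap d id t = tmap id e t ->
  tlift (fun u v => h (d u) v) t = tlift (fun u v => h u (e v)) t.
Proof. by move=> hB de; rewrite -(tlift_tmap _ id) // de tlift_tmap. Qed.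

(** * The comultiplication and its coderivations *)

Section Delta.
Variables (K : fieldType) (A : vectType K) (mul : A -> A -> A).
Hypothesis mulB : bilinear_map mul.
Let mE := bilinear_rules mulB.
Let pE := bilinear_rules (pure_bilinear A A).

Lemma Delta_linear r : linear (Delta mul r).
Proof.
move=> c a b; rewrite /Delta /tmap !(tliftD, tliftN, tliftZ).
by apply: eq_tlift => u v; rewrite !mE !pE scalerBr opprD addrACA.
Qed.

Lemma Delta_coderivation (d e : A -> A) r a : linear d -> linear e ->
  (forall u v, mul (e u) v = mul u (d v) + e (mul u v)) ->
  (forall u v, mul u (e v) = mul (d u) v + e (mul u v)) ->
  tmap d id r = tmap id e r -> tmap e id r = tmap id d r ->
  Delta mul r (e a) = tmap e id (Delta mul r a) + tmap id e (Delta mul r a).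
Proof.
move=> dL eL adml admr de ed.
have pB := @pure_comp_bilinear K A A A A.
have mL b : linear (mul b) by case: mulB.
have mR b : linear (mul^~ b) by case: mulB.
rewrite /Delta /tmap !tlift_rules -!/(tmap _ _ _) !tmap_comp //.
have -> : tmap e (mul a) r = tmap id (fun v => mul a (d v)) r.
  by apply: (tlift_transfer (h := fun u v => u ⊗ mul a v) _ ed); apply: pB.
have -> : tmap (mul^~ a) e r = tmap (fun u => mul (d u) a) id r.
  rewrite /tmap -(tlift_transfer (h := fun u v => mul u a ⊗ v) _ de) //.
  exact: pB.
have p'E := bilinear_map_rules (pure_bilinear A A).
rewrite /tmap !(tliftD, tliftN); apply: eq_tlift => u v /=.
by rewrite adml admr !p'E; zmod.
Qed.

End Delta.

(** * Operators applied to the associative Yang-Baxter equation *)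

Section AYB.
Variables (K : fieldType) (A : vectType K) (mul : A -> A -> A).
Hypothesis mulB : bilinear_map mul.
Variables (r : tens A A) (d e d' e' : 'End(A)).
Hypotheses (de : tmap d id r = tmap id e r) (ed : tmap e id r = tmap id d r).
Hypothesis de' : tmap d' id r = tmap id e' r.

Let mE := bilinear_rules mulB.
Let pE := bilinear_rules (pure_bilinear A A).
Let qE := bilinear_rules (pure_bilinear (tens A A) A).
Let bilin := (mE, pE, qE).

(** Every operator that falls on a bare factor of r is traded for its partner on the other factor,
    hence inside a product. The terms are then ready to be antisymmetrized in the two pairs (d, e)
    and (d', e'). *)
Lemma tmap_AYB : tmap (tmap id e) e' (AYB mul r) =
  tlift (fun a b => tlift (fun a' b' =>
    mul (d a) (d' a') ⊗ b ⊗ b' + a ⊗ a' ⊗ e' (mul b (d b'))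
    - a ⊗ e (mul (d' a') b) ⊗ b') r) r.
Proof.
have tL := @tlift_linear K.
have tr1 := tlift_transfer _ de; have tr2 := tlift_transfer _ de'.
have tr3 := tlift_transfer _ ed.
transitivity (tlift (fun a b => tlift (fun a' b' =>
    mul a a' ⊗ e b ⊗ e' b' + a ⊗ e a' ⊗ e' (mul b b')
    - a ⊗ e (mul a' b) ⊗ e' b') r) r).
  rewrite (linear_tlift (L := tmap (tmap id e) e')); last exact: tL.
  apply: eq_tlift => a b.
  rewrite (linear_tlift (L := tmap (tmap id e) e')); last exact: tL.
  apply: eq_tlift => a' b'.
  have pureE p q : tmap (tmap id e) e' (p ⊗ q) = tmap id e p ⊗ e' q.
    rewrite [LHS]tlift_pure //; apply: pure_comp_bilinear; first exact: tL.
    exact: linearP.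
  have pureE' p q : tmap id e (p ⊗ q) = p ⊗ e q.
    rewrite [LHS]tlift_pure //; apply: pure_comp_bilinear => //.
    exact: linearP.
  have TL : linear (@tmap K (tens A A) A (tens A A) A (tmap id e) e').
    exact: tlift_linear.
  by rewrite !(linear_rules TL) !pureE !pureE'.
have split3 (F G H : A -> A -> A -> A -> tens (tens A A) A) :
    tlift (fun a b => tlift (fun a' b' =>
      F a b a' b' + G a b a' b' - H a b a' b') r) r =
    tlift (fun a b => tlift (F a b) r) r + tlift (fun a b => tlift (G a b) r) r
    - tlift (fun a b => tlift (H a b) r) r.
  rewrite tliftN !tliftD; apply: eq_tlift => a b.
  by rewrite tliftN !tliftD.
rewrite !split3; congr (_ + _ - _).
- rewrite (tr1 _ (fun a b =>
    tlift (fun a' b' => mul a (d' a') ⊗ b ⊗ b') r)).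
    apply: eq_tlift => a b.
    rewrite (tr2 _ (fun a' b' => mul a a' ⊗ e b ⊗ b')) //.
    by split=> x c u v; rewrite ?linearP !bilin.
  apply: tlift_bilinear => x y.
  by split=> z c u v; rewrite ?linearP !bilin.
- apply: eq_tlift => a b.
  rewrite (tr3 _ (fun a' b' => a ⊗ a' ⊗ e' (mul b b'))) //.
  by split=> x c u v; rewrite ?(linearP, bilin).
apply: eq_tlift => a b.
rewrite (tr2 _ (fun a' b' => a ⊗ e (mul a' b) ⊗ b')) //.
by split=> x c u v; rewrite ?(linearP, bilin).
Qed.

End AYB.

(** * Associativity of the dual product *)

Section DualProduct.
Variables (K : fieldType) (A : vectType K) (mul : A -> A -> A) (r : tens A A).
Hypotheses (mulP : associative_algebra mul) (mulC : commutative mul).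
Hypothesis r_AYB : AYB mul r = 0.
Let dmul := dual_op (Delta mul r).
Let mE := bilinear_map_rules (assoc_bilinear mulP).
Let mA := assoc_mulA mulP.
Let mL a : linear (mul a). Proof. by case: mulP => [[]]. Qed.
Let mR a : linear (mul^~ a). Proof. by case: mulP => [[]]. Qed.

(** The two contractions of r: [R x] is (x ⊗ id)(r) and [T y] is (id ⊗ y)(r). *)
Let R (x : dual A) := sharp r x.
Let T (y : dual A) := tlift (fun u v => (y v : K) *: u) r.

Lemma tpair_bilinear (x y : dual A) :
  bilinear_map (fun u v => (x u * y v : K^o)).
Proof.
split=> u c v w; rewrite linearP /=; first by rewrite mulrDr mulrCA.
by rewrite mulrDl -mulrA.
Qed.

Lemma lfun_tlift (z : dual A) (f : A -> A -> A) (t : tens A A) :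
  z (tlift f t) = tlift (fun u v => (z (f u v) : K^o)) t.
Proof. by apply: linear_tlift; apply: linearP. Qed.

Lemma dual_op_Delta_tlift x y a : dmul x y a =
  tlift (fun u v => (x u * y (mul a v) - x (mul a u) * y v : K^o)) r.
Proof.
rewrite /dmul dual_opE; last by apply: Delta_linear; case: mulP.
rewrite /tpair /Delta !tlift_rules !tlift_tmap; try exact: tpair_bilinear.
by rewrite tliftN tliftD; apply: eq_tlift => u v; rewrite (mulC u).
Qed.

Lemma dual_op_DeltaE x y a : dmul x y a = y (mul a (R x)) - x (mul a (T y)).
Proof.
rewrite dual_op_Delta_tlift (linear_tlift _ _ (mL a)) (linear_tlift _ _ (mL a)).
rewrite !lfun_tlift !tliftN !tliftD.
apply: eq_tlift => u v; rewrite !mE.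
by congr (_ - _); rewrite linearZ // mulrC.
Qed.

Lemma dual_op_Delta_bilinear : bilinear_map dmul.
Proof.
have RL : linear R.
  move=> c x y; rewrite /R /sharp tliftZ tliftD; apply: eq_tlift => u v.
  by rewrite add_lfunE scale_lfunE scalerDl scalerA.
have TL : linear T.
  move=> c x y; rewrite /T tliftZ tliftD; apply: eq_tlift => u v.
  by rewrite add_lfunE scale_lfunE scalerDl scalerA.
split=> x c y z; apply/lfunP => a;
  rewrite add_lfunE scale_lfunE !dual_op_DeltaE;
  rewrite ?RL ?TL !mE add_lfunE scale_lfunE !linearD !linearZ /=;
  exact: addrACA.
Qed.

Lemma dual_op_DeltaA : associative dmul.
Proof.
have pB := tpair_bilinear.
have bZ (U V W : vectType K) (f : U -> K^o) (g : V -> W) :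
    linear f -> linear g -> bilinear_map (fun u v => (f u : K) *: g v).
  move=> fL gL; split=> u c v w; rewrite ?fL ?gL.
    by rewrite scalerDr !scalerA mulrC.
  by rewrite scalerDl -scalerA.
have dZ (x y : dual A) a (c : A) : (dmul x y a : K) *: c = tlift (fun u v =>
    (x u * y (mul a v) - x (mul a u) * y v) *: c) r.
  rewrite dual_op_Delta_tlift.
  rewrite (linear_tlift (L := fun k : K^o => (k : K) *: c)) //.
  by move=> k u v; rewrite scalerDl -scalerA.
have Rmul x y : R (dmul x y) = mul (R x) (R y).
  (* [L] is x ⊗ y ⊗ id. In [L (AYB mul r)] the middle term gives the product of [R x] and [R y], and
     the other two give minus [R (dmul x y)]. *)
  pose L := tlift (fun p (c : A) => (tpair x y p : K) *: c).
  have L3 p q c : L (p ⊗ q ⊗ c) = (x p * y q) *: c.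
    rewrite /L tlift_pure; last by apply: bZ => //; apply: tlift_linear.
    by rewrite [tpair x y _]tlift_pure //; exact: pB.
  have Llin : linear L by exact: tlift_linear.
  have LL := linear_rules Llin.
  apply/eqP; rewrite -subr_eq0 -oppr_eq0 opprB; apply/eqP.
  transitivity (L (AYB mul r)); last first.
    by rewrite r_AYB linear_zero.
  rewrite [RHS](linear_tlift (L := L)); last exact: tlift_linear.
  rewrite {1 2}/R /sharp (linear_tlift _ _ (mR _)).
  under [X in _ - X]eq_tlift do rewrite dZ.
  rewrite [X in _ - X]tlift_exchange tliftN tliftD; apply: eq_tlift => a b.
  rewrite [RHS](linear_tlift (L := L)); last exact: tlift_linear.
  rewrite /R /sharp (linear_tlift _ _ (mL _)) tliftN tliftD.
  apply: eq_tlift => a' b'; rewrite !LL !L3 !mE.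
  by rewrite !scalerBl !scalerA (mulC a' a) (mulC a' b) (mulrC (y a')); zmod.
have Tmul y z : T (dmul y z) = - mul (T y) (T z).
  (* [L] is id ⊗ y ⊗ z. Now the first term of A(r) gives the product of [T y] and [T z], and the
     other two give [T (dmul y z)]. *)
  pose F p (c : A) := tlift (fun u v => (y v * z c) *: u) (p : tens A A).
  pose L := tlift F.
  have L3 p q c : L (p ⊗ q ⊗ c) = (y q * z c) *: p.
    rewrite /L tlift_pure.
      rewrite /F tlift_pure //; split=> u k v w.
        by rewrite linearP /= mulrDl scalerDl -mulrA scalerA.
      by rewrite scalerDr !scalerA mulrC.
    split=> u; last exact: tlift_linear.
    move=> k v w; rewrite /F tliftZ tliftD; apply: eq_tlift => a b.
    by rewrite linearP /= mulrDr scalerDl mulrCA scalerA.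
  have Llin : linear L by exact: tlift_linear.
  have LL := linear_rules Llin.
  apply/eqP; rewrite -addr_eq0; apply/eqP.
  transitivity (L (AYB mul r)); last first.
    by rewrite r_AYB linear_zero.
  rewrite [RHS](linear_tlift (L := L)); last exact: tlift_linear.
  rewrite {1 2}/T (linear_tlift _ _ (mR _)) tliftD; apply: eq_tlift => a b.
  rewrite [RHS](linear_tlift (L := L)); last exact: tlift_linear.
  rewrite dZ /T (linear_tlift _ _ (mL _)) tliftD.
  apply: eq_tlift => a' b'; rewrite !LL !L3 !mE.
  by rewrite !scalerBl !scalerA (mulC b a') (mulrC (y b)); zmod.
(* Both bracketings, evaluated at a, become z(a R(x) R(y)) - y(a R(x) T(z)) + x(a T(y) T(z)). *)
move=> x y z; apply/lfunP => a; rewrite !dual_op_DeltaE Rmul Tmul.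
rewrite !mE linearN opprK -!mA (mulC (T z) (R x)) (mulC (T z) (T y)).
by rewrite opprD opprK addrA.
Qed.

End DualProduct.

(** * From the associative to the Poisson structure maps *)

Section Coboundary.
Variables (K : fieldType) (A : vectType K) (mul br : A -> A -> A).
Variables (d1 d2 e1 e2 : 'End(A)).
Hypotheses (mulP : associative_algebra mul) (mulC : commutative mul).
Hypothesis brE : forall a b, br a b = mul (d1 a) (d2 b) - mul (d2 a) (d1 b).
Hypothesis adm1 : forall a b, mul a (e1 b) = mul (d1 a) b + e1 (mul a b).
Hypothesis adm2 : forall a b, mul a (e2 b) = mul (d2 a) b + e2 (mul a b).
Hypothesis ed_swap : forall a b, mul (e2 (d1 a)) b = mul (e1 (d2 a)) b.

(** Expanding a e2(d1 b) = a e1(d2 b) by admissibility produces the two halves of the bracket. This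
    is the form in which [ed_swap] enters below. *)
Let e_br a b : e2 (mul a (d1 b)) = e1 (mul a (d2 b)) + br a b.
Proof.
have := ed_swap b a; rewrite !(mulC _ a) adm1 adm2 => E.
by apply: (addrI (mul (d2 a) (d1 b))); rewrite E brE; zmod.
Qed.

Let mulB := assoc_bilinear mulP.
Let mE := bilinear_map_rules mulB.
Let pE := bilinear_map_rules (pure_bilinear A A).
Let qE := bilinear_map_rules (pure_bilinear (tens A A) A).
Let mL a : linear (mul a). Proof. by case: mulB. Qed.
Let mR a : linear (mul^~ a). Proof. by case: mulB. Qed.
Let eL (f : 'End(A)) : linear f. Proof. exact: linearP. Qed.

Variable t : tens A A.
Hypothesis de1 : tmap d1 id t = tmap id e1 t.
Hypothesis ed1 : tmap e1 id t = tmap id d1 t.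
Hypothesis de2 : tmap d2 id t = tmap id e2 t.
Hypothesis ed2 : tmap e2 id t = tmap id d2 t.

Lemma Delta_coboundary a :
  tmap e1 e2 (Delta mul t a) - tmap e2 e1 (Delta mul t a) =
  tmap id (br a) t + tmap (br a) id t.
Proof.
(* In each term of (e ⊗ e') Delta_t(a), the operator on the factor not multiplied by a is moved
   across; antisymmetrizing then leaves exactly the differences computed by [e_br]. *)
have half (d e d' e' : 'End(A)) : tmap e id t = tmap id d t ->
    tmap d' id t = tmap id e' t -> tmap e e' (Delta mul t a) =
    tmap id (fun v => e' (mul a (d v))) t
    - tmap (fun u => e (mul (d' u) a)) id t.
  move=> ed de; rewrite /Delta /tmap !tlift_rules -!/(tmap _ _ _) !tmap_comp //.
  congr (_ - _).
    apply: (tlift_transfer (h := fun u v => u ⊗ e' (mul a v)) _ ed).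
    apply: pure_comp_bilinear (fun v => e' (mul a v)) _ _ => // c u v.
    by rewrite mL eL.
  rewrite /tmap (tlift_transfer (h := fun u v => e (mul u a) ⊗ v) _ de) //.
  apply: (pure_comp_bilinear (f := fun u => e (mul u a))) => // c u v.
  by rewrite mR eL.
rewrite (half _ _ _ _ ed1 de2) (half _ _ _ _ ed2 de1).
rewrite /tmap !(tliftD, tliftN); apply: eq_tlift => u v /=.
by rewrite ![mul _ a]mulC !e_br !pE; zmod.
Qed.

(** After [tmap_AYB], the first terms differ by the bracket by definition, and the second and third
    ones by [e_br]. *)
Lemma CYB_of_AYB : CYB br t = tmap (tmap id e1) e2 (AYB mul t)
                              - tmap (tmap id e2) e1 (AYB mul t).
Proof.
rewrite (tmap_AYB mulB de1 ed1 de2) (tmap_AYB mulB de2 ed2 de1) tliftN tliftD.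
apply: eq_tlift => a b.
rewrite tliftN tliftD; apply: eq_tlift => a' b'.
by rewrite ![mul (_ a') b]mulC !e_br brE !pE !qE; zmod.
Qed.

End Coboundary.

(** * The pairing against flips and transposes *)

Section DualPairing.
Variables (K : fieldType) (A : vectType K).

Lemma tpair_flip (x y : dual A) t : tpair x y (flip t) = tpair y x t.
Proof.
rewrite /flip (linear_tlift (L := fun t => (tpair x y t : K^o))); last first.
  exact: tlift_linear.
rewrite [RHS]/tpair; apply: (@eq_tlift K A A K^o) => u v.
rewrite [tpair _ _ _]tlift_pure; first exact: mulrC.
exact: tpair_bilinear.
Qed.

Lemma tpair_tmap (x y : dual A) (f g : 'End(A)) t :
  tpair x y (tmap f g t) = tpair (x \o f)%VF (y \o g)%VF t.
Proof.
rewrite [LHS]tlift_tmap; last exact: tpair_bilinear.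
by apply: (@eq_tlift K A A K^o) => u v; rewrite !comp_lfunE.
Qed.

End DualPairing.

(** The flip turns the condition for (e, d) into the one for (d, e), so the two together pass to r +
    flip r. *)
Lemma symmetric_part_transfer (K : fieldType) (A : vectType K)
    (d e : 'End(A)) (r : tens A A) :
  tmap d id r = tmap id e r -> tmap e id r = tmap id d r ->
  tmap d id (symmetric_part r) = tmap id e (symmetric_part r).
Proof.
move=> de ed; have eL (f : 'End(A)) : linear f by exact: linearP.
rewrite /symmetric_part /tmap !tlift_rules -!/(tmap _ _ _) de.
congr (_ *: (_ + _)).
by rewrite !(tmap_flip (K := K)) // ed.
Qed.

(** * The induced quasi-triangular Poisson bialgebra *)

Section InducedPoisson.
Variables (K : fieldType) (A : vectType K) (mul : A -> A -> A).
Variables (d1 d2 e1 e2 : 'End(A)) (r : tens A A).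
Let br a b := mul (d1 a) (d2 b) - mul (d2 a) (d1 b).
Let delta a := tmap e1 e2 (Delta mul r a) - tmap e2 e1 (Delta mul r a).
Hypothesis comm : commutative_cocommutative mul (Delta mul r).
Hypothesis ed_swap : forall a b, mul (e2 (d1 a)) b = mul (e1 (d2 a)) b.
Hypothesis qt : quasi_triangular_dASI mul [tuple d1; d2] [tuple e1; e2] r.

Let k1 : 'I_2 := Ordinal (isT : 0 < 2)%N.
Let k2 : 'I_2 := Ordinal (isT : 1 < 2)%N.
Let eL (f : 'End(A)) : linear f. Proof. exact: linearP. Qed.

Lemma induced_quasi_triangular_poisson :
  quasi_triangular_poisson br mul delta (Delta mul r) r.
Proof.
have [mulC Dflip] := comm.
have [[mulP der comd] [come adml admr] [r_AYB rPhi rPsi] inv] := qt.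
have [mulB mulA] := mulP.
have [der1 der2] := (der k1, der k2); have c12 := comd k1 k2.
have [al1 al2] := (adml k1, adml k2); have [ar1 ar2] := (admr k1, admr k2).
have ce := come k1 k2.
have /eqP := rPhi k1; have /eqP := rPhi k2.
have /eqP := rPsi k1; have /eqP := rPsi k2.
rewrite !subr_eq0 => /eqP ed2 /eqP ed1 /eqP de2 /eqP de1.
rewrite !(tnth_nth 0) /= in der1 der2 c12 al1 al2 ar1 ar2 ce de1 de2 ed1 ed2.
have brP : poisson_algebra br mul.
  exact: (differential_poisson_algebra mulP mulC (eL d1) (eL d2)).
have deltaE a : delta a = tmap id (br a) r + tmap (br a) id r.
  exact: (Delta_coboundary mulP mulC (fun _ _ => erefl) ar1 ar2 ed_swap).
have DE a : Delta mul r a = tmap id (mul a) r - tmap (mul a) id r.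
  by congr (_ - _); apply: eq_tmap => // u; apply: mulC.
have DL := Delta_linear mulB r.
have deltaL : linear delta.
  move=> c a b; rewrite /delta DL /tmap !tlift_rules -!/(tmap _ _ _).
  by rewrite !scalerBr; zmod.
have sE a : tmap (mul a) id (symmetric_part r) =
            tmap id (mul a) (symmetric_part r).
  apply/eqP; rewrite -subr_eq0 -(inv a); apply/eqP; congr (_ - _).
  by apply: eq_tmap => // u; apply: mulC.
split=> //; last first.
- move=> a; rewrite sE subrr; split=> //.
  rewrite addrC.
  rewrite -(Delta_coboundary mulP mulC (fun _ _ => erefl) ar1 ar2 ed_swap) //;
    try by apply: symmetric_part_transfer.
  have -> : Delta mul (symmetric_part r) a = 0.
    rewrite /Delta -(sE a); apply/eqP; rewrite subr_eq0; apply/eqP.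
    by apply: eq_tmap => // u; apply: mulC.
  by rewrite /tmap !(linear_zero (tlift_linear _)) subrr.
- split=> //.
  rewrite (CYB_of_AYB mulP mulC (fun _ _ => erefl) ar1 ar2 ed_swap) //.
  by rewrite r_AYB /tmap !(linear_zero (tlift_linear _)) subrr.
split=> //.
(* [pre e] is the transpose of e; [preM] dualizes [Delta_coderivation]. *)
- pose pre (e : 'End(A)) (x : dual A) : dual A := (x \o e)%VF.
  have preL e : linear (pre e).
    by move=> c x y; rewrite /pre comp_lfunDl comp_lfunZl.
  have preM (d e : 'End(A)) : 
     (forall u v, mul (e u) v = mul u (d v) + e (mul u v)) ->
     (forall u v, mul u (e v) = mul (d u) v + e (mul u v)) ->
     tmap d id r = tmap id e r -> tmap e id r = tmap id d r ->
     forall x y, pre e (dual_op (Delta mul r) x y) =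
     dual_op (Delta mul r) (pre e x) y + dual_op (Delta mul r) x (pre e y).
    move=> al ar de ed x y; apply/lfunP => a.
    rewrite add_lfunE /pre comp_lfunE !dual_opE //.
    rewrite (Delta_coderivation mulB a (eL d) (eL e)) //.
    rewrite {1}/tpair tlift_rules -!/(tpair _ _ _).
    (* The function [id] is replaced by the identity endomorphism, since [tpair_tmap] is about
       elements of ['End(A)]. *)
    have id1 : (\1%VF : 'End(A)) =1 id by move=> u; rewrite id_lfunE.
    rewrite -(eq_tmap _ (frefl e) id1) -(eq_tmap _ id1 (frefl e)).
    by rewrite !tpair_tmap !comp_lfun1r.
  apply: (differential_poisson_algebra (D1 := pre e1) (D2 := pre e2)) => //.
  + split; first exact: dual_op_Delta_bilinear.
    exact: dual_op_DeltaA.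
  + move=> x y; apply/lfunP => a.
    by rewrite !dual_opE // {1}Dflip tpair_flip.
  + exact: preM al1 ar1 de1 ed1.
  + exact: preM al2 ar2 de2 ed2.
  + by move=> x; apply/lfunP => a; rewrite /pre !comp_lfunE ce.
  (* Pairing with (e1 ⊗ e2 - e2 ⊗ e1) Delta_r moves the operators onto x and y, which is the bracket
     induced by the transposes. *)
  move=> x y; apply/lfunP => a.
  rewrite add_lfunE opp_lfunE !dual_opE // /delta.
  by rewrite {1}/tpair !tlift_rules -!/(tpair _ _ _) !tpair_tmap.
- by move=> a b; rewrite !deltaE (coboundary_delta_br brP).
- by move=> a b; rewrite !DE (coboundary_Delta_mul brP).
- by move=> a b; rewrite !deltaE !DE (coboundary_delta_mul brP).
by move=> a b; rewrite !deltaE !DE (coboundary_Delta_br brP).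
Qed.

End InducedPoisson.

Unset Implicit Arguments.
Theorem theorem5p22 (K : fieldType) (charK0 : [pchar K] =i pred0)
    (A : vectType K) (mul : A -> A -> A) (d1 d2 e1 e2 : 'End(A))
    (r : tens A A) :
  let Phi := [tuple d1; d2] in
  let Psi := [tuple e1; e2] in
  let br := fun a b => mul (d1 a) (d2 b) - mul (d2 a) (d1 b) in
  let delta := fun a =>
    tmap e1 e2 (Delta mul r a) - tmap e2 e1 (Delta mul r a) in
  commutative_cocommutative mul (Delta mul r) ->
  (forall a b, mul (e2 (d1 a)) b = mul (e1 (d2 a)) b) ->
  [/\ quasi_triangular_dASI mul Phi Psi r ->
        quasi_triangular_poisson br mul delta (Delta mul r) r,
      triangular_dASI mul Phi Psi r ->
        triangular_poisson br mul delta (Delta mul r) r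
    & factorizable_dASI mul Phi Psi r ->
        factorizable_poisson br mul delta (Delta mul r) r].
Proof.
move=> Phi Psi br delta comm ed_swap.
have qtP := induced_quasi_triangular_poisson comm ed_swap.
(* Antisymmetry and nondegeneracy concern r alone, so they carry over unchanged. *)
by split=> [|[qt rS]|[qt rS]]; [exact: qtP | split=> //; exact: qtP
  | split=> //; exact: qtP].
Qed.
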